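(* There exists a universal constant $c>0$ such that the following holds. Let $n,r$ be integers such that $r<\log n$, and consider the random graph $G(n,p_0)$, where $p_0\in(0,1)$ is chosen such that $\binom{n}{r}\cdot p_0^{\binom{r}{2}}=1/2$. Let $f$ be the function on graphs on $n$ labelled vertices defined by $f(G)=1$ if $G$ contains a copy of the complete graph $K_r$ as an induced subgraph, and $f(G)=0$ otherwise. Then \[ \mathrm{Ent}_{p_0}(f)\ge c\cdot p_0\log(1/p_0)\cdot \mathrm{I}_{p_0}(f). \]
   Context: In the model $G(n,p)$ the probability space is $\{0,1\}^N$ with $N=\binom n2$, endowed with the product measure $\mu_p=(p\,\delta_{\{1\}}+(1-p)\,\delta_{\{0\}})^{\otimes N}$; coordinates correspond to the potential edges of a graph on $n$ labelled vertices, each edge being present independently with probability $p$. Thus $f$ is regarded as a function $\{0,1\}^N\to\{0,1\}$. Elements of $\{0,1\}^N$ are identified with subsets of $\{1,\ldots,N\}$ (sets of edges). For $S,T\subset\{1,\ldots,N\}$ let \[ u_S(T)=\Big(-\sqrt{\tfrac{1-p}{p}}\Big)^{|S\cap T|}\Big(\sqrt{\tfrac{p}{1-p}}\Big)^{|S\setminus T|}. \] These form an orthonormal basis of $L^2(\mu_p)$, and $\hat f(S)=\mathbb{E}_{\mu_p}[f\cdot u_S]$. The spectral entropy is \[ \mathrm{Ent}_p(f)=\sum_{S\subset\{1,\ldots,N\}}\hat f(S)^2\log\left(\frac{1}{\hat f(S)^2}\right), \] with coefficients taken with respect to $\mu_p$ and zero coefficients contributing $0$. The influence of coordinate $i$ is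 $\mathrm{I}_i^p(f)=\Pr_{x\sim\mu_p}[f(x)\ne f(x\oplus e_i)]$, where $x\oplus e_i$ is $x$ with $x_i$ replaced by $1-x_i$, and the total influence is $\mathrm{I}_p(f)=\sum_{i=1}^N \mathrm{I}_i^p(f)$. All logarithms are to base $2$. *)

(* Defs.v *)
From mathcomp Require Import all_boot all_order all_algebra.
From mathcomp Require Import reals exp.

Set Implicit Arguments.
Unset Strict Implicit.
Unset Printing Implicit Defensive.

Import Order.TTheory GRing.Theory Num.Theory.
Local Open Scope ring_scope.

Definition log2 (R : realType) (x : R) : R := ln x / ln 2.

(* A point of the discrete cube {0,1}^T is the set of its coordinates equal
   to 1. *)
Section BiasedCube.
Variables (R : realType) (T : finType).
Implicit Types (p : R) (f : {set T} -> bool) (S x : {set T}).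

Definition cube_measure p x : R := \prod_(i : T) (if i \in x then p else 1 - p).

Definition cube_Pr p (A : pred {set T}) : R := \sum_(x | A x) cube_measure p x.

Definition cube_E p (g : {set T} -> R) : R := \sum_x cube_measure p x * g x.

Definition fourier_char p S x : R :=
  (- Num.sqrt ((1 - p) / p)) ^+ #|S :&: x|
  * (Num.sqrt (p / (1 - p))) ^+ #|S :\: x|.

Definition fourier_coef p f S : R :=
  cube_E p (fun x => (f x)%:R * fourier_char p S x).

(* A vanishing coefficient contributes 0 whatever the value of ln at 0^-1,
   because of the factor in front of the logarithm. *)
Definition spectral_entropy p f : R :=
  \sum_(S : {set T})
    fourier_coef p f S ^+ 2 * log2 (1 / fourier_coef p f S ^+ 2).

Definition flip (i : T) x : {set T} := if i \in x then x :\ i else i |: x.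

Definition influence p f (i : T) : R :=
  cube_Pr p (fun x => f x != f (flip i x)).

Definition total_influence p f : R := \sum_(i : T) influence p f i.

End BiasedCube.

(* A graph on n labelled vertices is its set of edges, i.e. a point of the cube
   with coordinates indexed by the potential edges. *)
Definition edge (n : nat) : finType := {e : {set 'I_n} | #|e| == 2%N}.

Definition adj (n : nat) (G : {set edge n}) : rel 'I_n :=
  [rel u v | [set u; v] \in [set val e | e in G]].

Definition complete_graph (r : nat) : {set edge r} := [set: edge r].

Definition has_induced_copy (r n : nat) (H : {set edge r}) (G : {set edge n}) :
    bool :=
  [exists phi : {ffun 'I_r -> 'I_n},
    injectiveb phi && [forall u, forall v, adj G (phi u) (phi v) == adj H u v]].

Definition clique_indicator (r n : nat) (G : {set edge n}) : bool :=
  has_induced_copy (complete_graph r) G.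

(* Main.v *)
Require Import Defs.
From mathcomp Require Import all_boot all_order all_algebra all_fingroup.
From mathcomp Require Import reals exp.
From mathcomp Require Import ring lra zify.

(* Write p for p0, m for 'C(r, 2), and let X be the number of r-cliques, so that
   E[X] = 1/2, f = 1 exactly when X > 0, and p^-m = 2 'C(n, r).

   If f(x) = 1 then every pivotal edge present in x lies in any given r-clique
   of x, and being pivotal is independent of being present; hence p I(f) is at
   most m E[f] <= m / 2, and it suffices to bound Ent(f) from below by a
   constant multiple of m log(1/p) = log(2 'C(n, r)).

   By invariance under vertex permutations, fhat(S)^2 <= 1 / 'C(n, v) where v is
   the number of vertices covered by S.  As v^2 <= n for v <= r, this is at most
   n^(-v/2), which is at most (2 'C(n, r))^(-1/36) as soon as 18 v >= r.

   It remains to see that the S with r / 18 <= v <= r and v >= 2 carry a constant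
   spectral mass.  Since f X = X, the sum of Xhat(S) fhat(S) is 1/2; the empty set
   contributes at most E[f] E[X] <= 1/4, the sets with 2 <= v < r / 18 contribute
   little by a second moment bound, and Cauchy-Schwarz applies to the others. *)

Set Implicit Arguments.
Unset Strict Implicit.
Unset Printing Implicit Defensive.

Import Order.TTheory GRing.Theory Num.Theory.
Local Open Scope ring_scope.

Lemma sum_subsets_prod (R : comNzRingType) (T : finType) (E : {set T})
    (F : T -> R) :
  \sum_(S : {set T} | S \subset E) \prod_(i in S) F i
    = \prod_(i in E) (1 + F i).
Proof.
rewrite [RHS]big_mkcond /=.
rewrite (eq_bigr (fun i => (if i \in E then F i else 0) + 1)); last first.
  by move=> i _; case: (i \in E); rewrite ?add0r // addrC.
rewrite bigA_distr /= big_mkcond; apply: eq_bigr => S _.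
case: ifPn => [/subsetP SE|/subsetPn [i iS iE]].
  by rewrite big_mkcond; apply: eq_bigr => i _; case: ifP => // /SE ->.
by rewrite (bigD1 i) //= iS (negPf iE) mul0r.
Qed.

(** * Fourier analysis on the biased cube *)

Section BiasedFourier.
Variables (R : realType) (T : finType) (p : R).
Hypothesis p01 : 0 < p < 1.
Implicit Types (S x E : {set T}) (f : {set T} -> bool).

Let p_gt0 : 0 < p. Proof. by case/andP: p01. Qed.
Let q_gt0 : 0 < 1 - p. Proof. by case/andP: p01; rewrite subr_gt0. Qed.
Let p_neq0 : p != 0. Proof. by rewrite gt_eqF. Qed.
Let q_neq0 : 1 - p != 0. Proof. by rewrite gt_eqF. Qed.

Lemma cube_measure_ge0 x : 0 <= cube_measure p x.
Proof. by apply: prodr_ge0 => i _; case: ifP => _; apply: ltW. Qed.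

(** Independence of the coordinates: a product of one-coordinate functions integrates factor by
    factor. The total mass, the orthogonality relations and the containment probabilities all reduce
    to this. *)
Lemma sum_cube_measure_prod (F G : T -> R) :
  \sum_x cube_measure p x * \prod_i (if i \in x then F i else G i)
    = \prod_i (p * F i + (1 - p) * G i).
Proof.
rewrite bigA_distr; apply: eq_bigr => x _.
by rewrite -big_split; apply: eq_bigr => i _; case: ifP.
Qed.

Lemma cube_E1 : cube_E p (fun _ : {set T} => 1) = 1.
Proof.
rewrite -[RHS](@big1_eq R 1 *%R T (index_enum T) xpredT).
have -> : \prod_(i : T) (1 : R) = \prod_(i : T) (p * 1 + (1 - p) * 1).
  by apply: eq_bigr => i _; ring.
rewrite -sum_cube_measure_prod; apply: eq_bigr => x _.
by rewrite big1 // => i _; case: ifP.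
Qed.

Lemma fourier_charE S x :
  fourier_char p S x =
  \prod_(i in S) (if i \in x then - Num.sqrt ((1 - p) / p)
                  else Num.sqrt (p / (1 - p))).
Proof.
rewrite (bigID (mem x)) /= /fourier_char; congr (_ * _).
  rewrite (eq_bigr (fun=> - Num.sqrt ((1 - p) / p))); last first.
    by move=> i /andP[_ ->].
  by rewrite big_const iter_mulr_1; congr (_ ^+ _); apply: eq_card => i; rewrite !inE.
rewrite (eq_bigr (fun=> Num.sqrt (p / (1 - p)))); last first.
  by move=> i /andP[_ /negPf->].
by rewrite big_const iter_mulr_1; congr (_ ^+ _); apply: eq_card => i; rewrite !inE andbC.
Qed.

Let sqrt_ratio_mul : Num.sqrt ((1 - p) / p) * Num.sqrt (p / (1 - p)) = 1.
Proof.
rewrite -sqrtrM ?divr_ge0 ?ltW //.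
by rewrite (_ : _ * _ = 1) ?sqrtr1 //; field; rewrite p_neq0 q_neq0.
Qed.

Lemma fourier_char_orthonormal S S' :
  cube_E p (fun x => fourier_char p S x * fourier_char p S' x) = (S == S')%:R.
Proof.
pose a : R := - Num.sqrt ((1 - p) / p); pose b := Num.sqrt (p / (1 - p)).
pose w (U : {set T}) c i : R := if i \in U then c else 1.
transitivity (\prod_i (p * (w S a i * w S' a i)
                       + (1 - p) * (w S b i * w S' b i))).
  rewrite -sum_cube_measure_prod; apply: eq_bigr => x _; congr (_ * _).
  rewrite !fourier_charE [X in X * _]big_mkcond [X in _ * X]big_mkcond -big_split.
  apply: eq_bigr => i _; rewrite /w.
  by case: (i \in S); case: (i \in S'); case: (i \in x).
have a2 : a * a = (1 - p) / p.
  by rewrite /a mulrNN -expr2 sqr_sqrtr // divr_ge0 // ltW.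
have b2 : b * b = p / (1 - p).
  by rewrite /b -expr2 sqr_sqrtr // divr_ge0 // ltW.
(* [a] and [b] are the values of a one-coordinate character at 1 and 0, so this says that it has
   mean zero. Multiplied by [b], the left side becomes -p + p. *)
have ab : p * a + (1 - p) * b = 0.
  have b0 : b != 0 by rewrite gt_eqF // sqrtr_gt0 divr_gt0.
  have ba : a * b = -1 by rewrite /a /b mulNr sqrt_ratio_mul.
  apply: (mulfI b0); rewrite mulr0 mulrDr mulrCA [b * a]mulrC ba mulrCA b2.
  by field.
case: eqP => [->|/eqP neqS].
  rewrite big1 // => i _; rewrite /w; case: ifP => _; last by ring.
  by rewrite a2 b2; field; rewrite p_neq0 q_neq0.
have [i Ni] : exists i, (i \in S) != (i \in S').
  apply/existsP; apply: contraR neqS; rewrite negb_exists => /forallP H.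
  by apply/eqP/setP => i; apply/eqP; have := H i; rewrite negbK.
rewrite (bigD1 i) //= /w; move: Ni.
by case: (i \in S); case: (i \in S'); rewrite // ?mulr1 ?mul1r ab mul0r.
Qed.

(** On a finite type [h] permutes the coordinates; the measure has the same factor law at each of
    them and the characters depend only on cardinalities, so both are preserved. *)
Lemma fourier_coef_imset f (h : T -> T) S :
    injective h -> (forall x, f (h @: x) = f x) ->
  fourier_coef p f (h @: S) = fourier_coef p f S.
Proof.
move=> h_inj fh; rewrite /fourier_coef /cube_E (reindex_inj (imset_inj h_inj)).
apply: eq_bigr => x _; rewrite fh; congr (_ * (_ * _)).
  rewrite /cube_measure (reindex_inj h_inj); apply: eq_bigr => i _.
  by rewrite (mem_imset _ _ h_inj).
rewrite /fourier_char !cardsD -imsetI; last by move=> ? ? _ _; apply: h_inj.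
by rewrite !card_imset.
Qed.

(** With [g] the Fourier expansion of f, E[f g] and E[g^2] both equal the sum of squares, and
    E[(f - g)^2] >= 0. As f takes the values 0 and 1, E[f^2] = E[f]. *)
Lemma bessel_inequality f :
  \sum_S fourier_coef p f S ^+ 2 <= cube_E p (fun x => (f x)%:R).
Proof.
pose c S := fourier_coef p f S.
pose g x := \sum_S c S * fourier_char p S x.
have fg : cube_E p (fun x => (f x)%:R * g x) = \sum_S c S ^+ 2.
  rewrite /cube_E /g.
  under eq_bigr do rewrite !mulr_sumr.
  rewrite exchange_big; apply: eq_bigr => S _.
  rewrite expr2 [X in _ = _ * X]/c /fourier_coef /cube_E mulr_sumr.
  by apply: eq_bigr => x _; ring.
have gg : cube_E p (fun x => g x * g x) = \sum_S c S ^+ 2.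
  transitivity (\sum_S \sum_U c S * c U *
     cube_E p (fun x => fourier_char p S x * fourier_char p U x)).
    rewrite /cube_E.
    under [RHS]eq_bigr do under eq_bigr do rewrite mulr_sumr.
    under [RHS]eq_bigr do rewrite exchange_big /=.
    rewrite [RHS]exchange_big; apply: eq_bigr => x _.
    rewrite /g mulr_suml mulr_sumr; apply: eq_bigr => S _.
    rewrite !mulr_sumr; apply: eq_bigr => S' _; ring.
  apply: eq_bigr => S _; rewrite (bigD1 S) //= fourier_char_orthonormal eqxx.
  rewrite big1 ?addr0 ?mulr1 // => S' /negPf.
  by rewrite eq_sym fourier_char_orthonormal => ->; rewrite mulr0.
have : 0 <= cube_E p (fun x => ((f x)%:R - g x) ^+ 2).
  by apply: sumr_ge0 => x _; rewrite mulr_ge0 ?cube_measure_ge0 ?sqr_ge0.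
have -> : cube_E p (fun x => ((f x)%:R - g x) ^+ 2)
  = cube_E p (fun x => (f x)%:R) - 2 * cube_E p (fun x => (f x)%:R * g x)
    + cube_E p (fun x => g x * g x).
  rewrite /cube_E mulr_sumr -sumrN -!big_split; apply: eq_bigr => x _ /=.
  by case: (f x) => /=; ring.
rewrite fg gg; lra.
Qed.

(* On one coordinate, [x_i = 1] has the expansion p (1 - sqrt((1-p)/p) u_i). *)
Lemma subset_indicator_expansion E x :
  (E \subset x)%:R =
  p ^+ #|E| * \sum_(S : {set T} | S \subset E)
                 (- Num.sqrt ((1 - p) / p)) ^+ #|S| * fourier_char p S x.
Proof.
rewrite (eq_bigr (fun S : {set T} => \prod_(i in S)
   (- Num.sqrt ((1 - p) / p) * (if i \in x then - Num.sqrt ((1 - p) / p)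
                  else Num.sqrt (p / (1 - p)))))); last first.
  by move=> S _; rewrite big_split /= big_const iter_mulr_1 fourier_charE.
rewrite sum_subsets_prod -[#|E|]/(#|mem E|) -iter_mulr_1 -big_const -big_split /=.
rewrite (eq_bigr (fun i => (i \in x)%:R)); last first.
  move=> i _; case: (i \in x) => /=.
    rewrite mulrNN -expr2 sqr_sqrtr ?divr_ge0 ?ltW //.
    by field.
  by rewrite mulNr sqrt_ratio_mul subrr mulr0.
case: (boolP (E \subset x)) => [/subsetP Ex|/subsetPn [i iE ix]].
  by rewrite big1 // => i /Ex ->.
by rewrite (bigD1 i) //= (negPf ix) mul0r.
Qed.

Lemma cube_E_mul_subset_indicator f E :
  cube_E p (fun x => (f x)%:R * (E \subset x)%:R) =
  \sum_(S : {set T} | S \subset E)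
     p ^+ #|E| * (- Num.sqrt ((1 - p) / p)) ^+ #|S| * fourier_coef p f S.
Proof.
rewrite /cube_E.
under eq_bigr do rewrite subset_indicator_expansion !mulr_sumr.
rewrite exchange_big; apply: eq_bigr => S _.
rewrite /fourier_coef /cube_E mulr_sumr; apply: eq_bigr => x _; ring.
Qed.

Lemma cube_E_subset_indicator E :
  cube_E p (fun x => (E \subset x)%:R) = p ^+ #|E|.
Proof.
transitivity (\sum_x cube_measure p x *
   \prod_i (if i \in x then 1 else (i \notin E)%:R)).
  apply: eq_bigr => x _; congr (_ * _).
  case: (boolP (E \subset x)) => [/subsetP Ex|/subsetPn [i iE ix]].
    rewrite big1 // => i _; case: ifPn => // ix.
    by rewrite (contra (Ex i) ix).
  by rewrite (bigD1 i) //= (negPf ix) iE mul0r.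
rewrite sum_cube_measure_prod (bigID (mem E)) /= [X in _ * X]big1; last first.
  by move=> i -> /=; ring.
rewrite (eq_bigr (fun=> p)); last by move=> i -> /=; ring.
by rewrite big_const iter_mulr_1 mulr1.
Qed.

(** The summands are the squared coefficients in [subset_indicator_expansion], up to the power of p
    in front. Each element of E contributes 1 + (1 - p)/p = 1/p. *)
Lemma sum_subsets_sqr_weight E :
  \sum_(S : {set T} | S \subset E) ((- Num.sqrt ((1 - p) / p)) ^+ #|S|) ^+ 2
    = p^-1 ^+ #|E|.
Proof.
rewrite (eq_bigr (fun S : {set T} => \prod_(i in S) ((1 - p) / p))); last first.
  move=> S _; rewrite big_const iter_mulr_1 -exprM mulnC exprM sqrrN.
  by rewrite sqr_sqrtr ?divr_ge0 ?ltW.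
rewrite sum_subsets_prod big_const iter_mulr_1; congr (_ ^+ _).
by field.
Qed.

End BiasedFourier.
(** * Influences and certificates *)

Section CertificateInfluence.
Variables (R : realType) (T : finType) (p : R).
Hypothesis p01 : 0 < p < 1.
Implicit Types (x y : {set T}) (f : {set T} -> bool) (i : T).

Lemma flipK i : involutive (flip i : {set T} -> {set T}).
Proof.
move=> x; rewrite /flip; case: (boolP (i \in x)) => ix.
  by rewrite setD11 setD1K.
by rewrite setU11 setU1K.
Qed.

Lemma in_flip i x : (i \in flip i x) = (i \notin x).
Proof. by rewrite /flip; case: ifP => ix; rewrite !inE eqxx. Qed.

Lemma cube_measure_flip i x : i \in x ->
  p * cube_measure p (flip i x) = (1 - p) * cube_measure p x.
Proof.
move=> ix; rewrite /cube_measure (bigD1 i) //= [in RHS](bigD1 i) //= in_flip ix /=.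
rewrite mulrCA; congr (_ * (_ * _)); apply: eq_bigr => j ji.
by rewrite /flip ix !inE ji.
Qed.

(* The event that i is pivotal does not depend on the coordinate i itself. *)
Lemma influence_pivotal f i :
  p * influence p f i =
  \sum_(x : {set T} | (i \in x) && (f x != f (flip i x))) cube_measure p x.
Proof.
rewrite /influence /cube_Pr (bigID (fun x => i \in x)) /=.
rewrite (eq_bigl (fun x : {set T} => (i \in x) && (f x != f (flip i x)))); last first.
  by move=> x; rewrite andbC.
rewrite [X in _ + X](reindex_inj (inv_inj (flipK i))) /=.
rewrite [X in _ + X](eq_bigl (fun x : {set T} =>
                                (i \in x) && (f x != f (flip i x)))); last first.
  by move=> x; rewrite flipK in_flip negbK eq_sym andbC.
rewrite mulrDr [X in _ + X]mulr_sumr.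
rewrite [X in _ + X](eq_bigr (fun x => (1 - p) * cube_measure p x)); last first.
  by move=> x /andP[ix _]; apply: cube_measure_flip.
by rewrite -mulr_sumr -mulrDl addrC subrK mul1r.
Qed.

(** By [influence_pivotal] the left side is the expected number of pivotal coordinates present in x.
    If f x holds, removing a coordinate outside the certificate E preserves E, so these coordinates
    lie in E. If f x fails there are none, since a certificate inside a subset of x also lies in
    x. *)
Lemma total_influence_certificate f m :
    (forall x, f x -> exists E : {set T},
       [/\ E \subset x, (#|E| <= m)%N & forall y, E \subset y -> f y]) ->
  p * total_influence p f <= m%:R * cube_E p (fun x => (f x)%:R).
Proof.
move=> cert; rewrite /total_influence mulr_sumr.
rewrite (eq_bigr _ (fun i _ => influence_pivotal f i)).
rewrite (exchange_big_dep xpredT) //= /cube_E mulr_sumr.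
apply: ler_sum => x _; rewrite sumr_const -[leLHS]mulr_natr mulrCA.
apply: ler_wpM2l; first exact: cube_measure_ge0.
case fx: (f x).
  have [E [Ex Em fE]] := cert x fx; rewrite mulr1 ler_nat.
  apply: leq_trans Em; apply: subset_leq_card; apply/subsetP => i.
  rewrite unfold_in => /andP[ix]; rewrite /flip ix; apply: contraR => iE.
  by rewrite fE //; apply/subsetP => j jE; rewrite !inE (subsetP Ex) // andbT;
    apply: contraNneq iE => <-.
rewrite mulr0 (_ : #|_| = 0%N) //; apply: eq_card0 => i; rewrite unfold_in.
apply/negbTE; rewrite negb_and negbK; case: (boolP (i \in x)) => //= ix.
rewrite eq_sym; apply/eqP/negbTE; apply: contraFN fx => /cert [E [Ex _ fE]].
by apply: fE; apply: subset_trans Ex _; rewrite /flip ix subsetDl.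
Qed.

End CertificateInfluence.
(** * Second moment of the number of cliques *)

Lemma leq_bin_expn n k : ('C(n, k) <= n ^ k)%N.
Proof.
apply: (@leq_trans (n ^_ k)); first by rewrite -bin_ffact leq_pmulr ?fact_gt0.
rewrite ffact_prod -[X in (_ <= n ^ X)%N](card_ord k) -prod_nat_const.
by apply: leq_prod => i _; apply: leq_subr.
Qed.

Lemma double_bin_leq_expn n k : (1 < k)%N -> (2 * 'C(n, k) <= n ^ k)%N.
Proof.
move=> k2; apply: (@leq_trans (n ^_ k)).
  by rewrite -bin_ffact mulnC leq_mul2l (@leq_trans 2`!) ?orbT // leq_fact.
rewrite ffact_prod -[X in (_ <= n ^ X)%N](card_ord k) -prod_nat_const.
by apply: leq_prod => i _; apply: leq_subr.
Qed.

(** After multiplication by k! both sides are products of k factors, compared through n (k - i) <=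
    (n - i) k. *)
Lemma expn_leq_bin n k : (k <= n)%N -> (n ^ k <= 'C(n, k) * k ^ k)%N.
Proof.
move=> kn; rewrite -(leq_pmul2r (fact_gt0 k)) mulnAC bin_ffact -ffactnn !ffact_prod.
rewrite -[X in (n ^ X)%N](card_ord k) -[X in (k ^ X)%N](card_ord k).
rewrite -!prod_nat_const -!big_split; apply: leq_prod => i _ /=.
have := ltn_ord i; nia.
Qed.

(** The successor covers k = 3, where 9 = 8 + 1; it costs nothing later, because 2^r < n means 2^r +
    1 <= n. *)
Lemma leq_expn2_sqr k : (1 < k)%N -> (k ^ 2 <= (2 ^ k).+1)%N.
Proof.
case: k => [|[|[|[|k]]]] // _.
suff : ((k.+4) ^ 2 <= 2 ^ k.+4)%N by move=> /leqW.
elim: k => // k IH; rewrite (expnS 2); apply: leq_trans _ (leq_mul (leqnn 2) IH).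
by rewrite -!mulnn; nia.
Qed.

Lemma leq_expn2_sextic k : (36 <= k)%N -> (16 * k ^ 6 <= 2 ^ k)%N.
Proof.
elim: k => // k IH; rewrite leq_eqVlt => /predU1P[<-|k36].
  (* For k = 36 the left side is 2^16 3^12 and the right side 2^16 2^20, so the base case is 27^4 <=
     32^4; no large unary number is evaluated. *)
  have h : ((3 ^ 3) ^ 4 <= (2 ^ 5) ^ 4)%N by rewrite leq_exp2r.
  rewrite -(@expnM 3) -(@expnM 2) in h.
  have -> : (36 = 2 ^ 2 * 3 ^ 2)%N by [].
  have -> : (16 = 2 ^ 4)%N by [].
  rewrite expnMn -!expnM mulnA -expnD.
  have -> : (2 ^ (2 ^ 2 * 3 ^ 2) = 2 ^ (4 + 2 * 6) * 2 ^ (5 * 4))%N by rewrite -expnD.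
  by rewrite leq_mul2l h orbT.
rewrite (expnS 2); apply: leq_trans _ (leq_mul (leqnn 2) (IH k36)).
(* This gives 125 (k + 1)^6 <= 216 k^6, and 216 < 250. *)
have h : ((5 * k.+1 ^ 2) ^ 3 <= (6 * k ^ 2) ^ 3)%N.
  by rewrite leq_exp2r // -!mulnn; nia.
rewrite (expnMn 5) (expnMn 6) -!expnM in h; move: h.
move: (k.+1 ^ (2 * 3))%N (k ^ (2 * 3))%N => a b h; lia.
Qed.

Lemma double_bin2 v : ('C(v, 2) * 2 = v * v.-1)%N.
Proof.
by case: v => // v; rewrite muln2 bin2 -[RHS]odd_double_half oddM /= andNb.
Qed.

(** Both sides count the pairs of an r-set and a v-subset of it, choosing the smaller or the larger
    set first. *)
Lemma bin_mul_bin n r v : (v <= r)%N ->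
  ('C(n, v) * 'C(n - v, r - v) = 'C(n, r) * 'C(r, v))%N.
Proof.
move=> vr; case: (leqP r n) => rn; last first.
  have [nv|vn] := ltnP n v; first by rewrite !(bin_small, mul0n) //; lia.
  by rewrite (@bin_small n r) // (@bin_small (n - v)) ?muln0 //; lia.
have f0 : (0 < v`! * (r - v)`! * (n - r)`!)%N by rewrite !muln_gt0 !fact_gt0.
apply/eqP; rewrite -(eqn_pmul2r f0); apply/eqP.
have h1 := bin_fact (leq_trans vr rn); have h2 := bin_fact rn.
have h3 := bin_fact vr.
have vn : (r - v <= n - v)%N by lia.
have h4 := bin_fact vn.
have e : (n - v - (r - v) = n - r)%N by lia.
rewrite e in h4.
transitivity (n`!)%N; first by rewrite -h1 -h4; ring.
by rewrite -h2 -h3; ring.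
Qed.
(* The squared norm of the part of the number of r-cliques that lives on the
   sets of edges covering exactly v vertices is at most
   [clique_weight n r p v]. *)
Definition clique_weight (R : realType) (n r : nat) (p : R) (v : nat) : R :=
  'C(n, v)%:R * ('C(n - v, r - v)%:R * p ^+ 'C(r, 2)) ^+ 2 * p^-1 ^+ 'C(v, 2).

(** * Decay of the clique weights away from v = 0 and v = r *)

Section CliqueWeights.
Variables (R : realType) (n r : nat) (p : R).
Hypothesis p01 : 0 < p < 1.
Hypothesis r_gt1 : (1 < r)%N.
Hypothesis n_large : (2 ^ r < n)%N.
Hypothesis p_critical : 'C(n, r)%:R * p ^+ 'C(r, 2) = 1 / 2.

Let p_gt0 : 0 < p. Proof. by case/andP: p01. Qed.
Let p_neq0 : p != 0. Proof. by rewrite gt_eqF. Qed.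
Let P_gt0 : 0 < p^-1. Proof. by rewrite invr_gt0. Qed.
Let P_ge1 : 1 <= p^-1.
Proof. by rewrite invf_ge1 //; case/andP: p01 => _ /ltW. Qed.
Let r_le_n : (r <= n)%N. Proof. by apply: ltnW (ltn_trans (ltn_expl r _) n_large). Qed.
Let n_gt0 : (0 < n)%N. Proof. by lia. Qed.
Let N_gt0 : 0 < n%:R :> R. Proof. by rewrite ltr0n. Qed.
Let rR_gt0 : 0 < r%:R :> R. Proof. by rewrite ltr0n ltnW. Qed.

Lemma invp_exp_critical : p^-1 ^+ 'C(r, 2) = 2 * 'C(n, r)%:R.
Proof.
have pm : p ^+ 'C(r, 2) != 0 by rewrite expf_neq0.
by apply: (mulIf pm); rewrite -mulrA p_critical -exprMn mulVf // expr1n; field.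
Qed.

Let invp_exp_r : (p^-1 ^+ r.-1) ^+ r = (2 * 'C(n, r)%:R) ^+ 2.
Proof. by rewrite -invp_exp_critical -!exprM mulnC double_bin2. Qed.

(** Compared after raising to the power r: since r (r - 1) = 2 'C(r, 2), the left side becomes (2
    'C(n, r))^2, and 2 'C(n, r) <= n^r. The matching lower bound uses (n/r)^r <= 'C(n, r). *)
Lemma invp_exp_le : p^-1 ^+ r.-1 <= n%:R ^+ 2.
Proof.
rewrite -(@ler_pXn2r _ _ (ltnW r_gt1)) ?nnegrE ?exprn_ge0 ?(ltW P_gt0) ?ler0n //
        invp_exp_r -exprM mulnC exprM.
rewrite ler_pXn2r ?nnegrE ?mulr_ge0 ?exprn_ge0 ?ler0n //.
by rewrite -natrX -natrM ler_nat double_bin_leq_expn.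
Qed.

Let ratio_exp_le_bin k : (k <= r)%N -> (n%:R / r%:R) ^+ k <= 'C(n, k)%:R :> R.
Proof.
move=> kr; rewrite expr_div_n ler_pdivrMr ?exprn_gt0 // -!natrX -natrM ler_nat.
apply: leq_trans (expn_leq_bin (leq_trans kr r_le_n)) _.
rewrite leq_mul2l; case: k kr => [|k] kr; first by rewrite !expn0 orbT.
by rewrite leq_exp2r ?kr ?orbT.
Qed.

Lemma invp_exp_ge : (n%:R / r%:R) ^+ 2 <= p^-1 ^+ r.-1.
Proof.
rewrite -(@ler_pXn2r _ _ (ltnW r_gt1)) ?nnegrE ?exprn_ge0 ?divr_ge0 ?ler0n ?(ltW P_gt0) //.
rewrite invp_exp_r -exprM mulnC exprM.
rewrite ler_pXn2r ?nnegrE ?mulr_ge0 ?exprn_ge0 ?divr_ge0 ?ler0n //.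
apply: le_trans (ratio_exp_le_bin (leqnn r)) _.
by rewrite ler_peMl ?ler0n // ler1n.
Qed.

Let bin_gt0R k : (k <= r)%N -> 0 < 'C(n, k)%:R :> R.
Proof. by move=> kr; rewrite ltr0n bin_gt0 (leq_trans kr). Qed.

Lemma clique_weight_ge0 v : 0 <= clique_weight n r p v.
Proof. by rewrite !mulr_ge0 ?exprn_ge0 ?ler0n // ltW. Qed.

Let weight4_ge0 v : 0 <= 4 * clique_weight n r p v.
Proof. by rewrite mulr_ge0 ?clique_weight_ge0. Qed.

(** By [bin_mul_bin] and criticality, 'C(n, v) 'C(n - v, r - v) p^'C(r, 2) = 'C(r, v) / 2; the
    factor 4 clears the square of 1/2. *)
Lemma clique_weightE v : (v <= r)%N ->
  4 * clique_weight n r p v = 'C(r, v)%:R ^+ 2 * p^-1 ^+ 'C(v, 2) / 'C(n, v)%:R.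
Proof.
move=> vr; have c0 : 'C(n, v)%:R != 0 :> R by rewrite gt_eqF ?bin_gt0R.
have h : 'C(n, v)%:R * ('C(n - v, r - v)%:R * p ^+ 'C(r, 2)) = 'C(r, v)%:R / 2.
  by rewrite mulrA -natrM bin_mul_bin // natrM mulrAC p_critical; field.
apply: (mulIf c0); rewrite divfK // /clique_weight.
transitivity (4 * ('C(n, v)%:R * ('C(n - v, r - v)%:R * p ^+ 'C(r, 2))) ^+ 2
   * p^-1 ^+ 'C(v, 2)); first by ring.
by rewrite h; field.
Qed.

(** Since 2 (v - 1) <= r - 1, [invp_exp_le] yields p^-(v - 1) <= n. Squaring turns 'C(v, 2) into v
    (v - 1), and the three factors are at most r^(4v), n^v and (r/n)^(2v). *)
Lemma clique_weight_low v : (0 < v)%N -> (v.*2 <= r)%N ->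
  (4 * clique_weight n r p v) ^+ 2 <= (r%:R ^+ 6 / n%:R) ^+ v.
Proof.
move=> v0 vr; have vr' : (v <= r)%N by clear -v0 vr; lia.
have Pv : p^-1 ^+ v.-1 <= n%:R.
  rewrite -(@ler_pXn2r _ 2) ?nnegrE ?exprn_ge0 ?(ltW P_gt0) ?ler0n // -exprM.
  by apply: le_trans invp_exp_le; apply: ler_weXn2l => //; clear -v0 vr; lia.
have Pv2 : (p^-1 ^+ 'C(v, 2)) ^+ 2 <= n%:R ^+ v.
  rewrite -exprM double_bin2 mulnC exprM lerXn2r ?nnegrE ?exprn_ge0 ?(ltW P_gt0) ?ler0n //.
have Cr : 'C(r, v)%:R <= r%:R ^+ v :> R by rewrite -natrX ler_nat leq_bin_expn.
have Cn : 'C(n, v)%:R^-1 <= (r%:R / n%:R) ^+ v :> R.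
  rewrite -[r%:R / _]invf_div exprVn lef_pV2 ?posrE ?exprn_gt0 ?divr_gt0 ?bin_gt0R //.
  exact: ratio_exp_le_bin.
rewrite clique_weightE // [leLHS]exprMn [X in X * _]exprMn.
have -> : (r%:R ^+ 6 / n%:R) ^+ v
    = ((r%:R ^+ v) ^+ 2) ^+ 2 * n%:R ^+ v * ((r%:R / n%:R) ^+ v) ^+ 2 :> R.
  rewrite !(exprAC _ v) -!(exprMn v); congr (_ ^+ v).
  by field; rewrite gt_eqF.
have C0 : 0 <= 'C(r, v)%:R :> R by rewrite ler0n.
have V0 : 0 <= 'C(n, v)%:R^-1 :> R by rewrite invr_ge0 ler0n.
apply: ler_pM => //; rewrite ?mulr_ge0 ?exprn_ge0 ?(ltW P_gt0) //; last first.
  by rewrite lerXn2r // nnegrE exprn_ge0 // divr_ge0 ?ler0n.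
apply: ler_pM => //; rewrite ?exprn_ge0 ?(ltW P_gt0) //.
by rewrite !lerXn2r ?nnegrE ?exprn_ge0 ?ler0n.
Qed.

(** With j = r - v, the weight is rewritten around v = r, where p has exponent 'C(r, 2) - 'C(v, 2).
    Twice this exponent is (r - 1 + v) j, while p^(r - 1) <= (r/n)^2 and p^v <= r/n. *)
Lemma clique_weight_high v : (v <= r)%N -> (r <= v.*2)%N ->
  (4 * clique_weight n r p v) ^+ 2 <= 4 * (r%:R ^+ 6 / n%:R) ^+ (r - v).
Proof.
move=> vr rv; set j := (r - v)%N.
have jr : (j <= r)%N by rewrite leq_subr.
have Cv := bin_gt0R vr; have Crv : 0 < 'C(r, v)%:R :> R by rewrite ltr0n bin_gt0.
have W : 4 * clique_weight n r p v
     = 2 * 'C(r, j)%:R * 'C(n - v, j)%:R * p ^+ ('C(r, 2) - 'C(v, 2)).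
  have m_le : ('C(v, 2) <= 'C(r, 2))%N by rewrite leq_bin2l.
  have e : p ^+ ('C(r, 2) - 'C(v, 2)) = p ^+ 'C(r, 2) * p^-1 ^+ 'C(v, 2).
    by rewrite -{2}(subnK m_le) exprD -mulrA -exprMn mulfV // expr1n mulr1.
  rewrite clique_weightE // e bin_sub //.
  have c0 : 'C(n, v)%:R != 0 :> R by rewrite gt_eqF.
  apply: (mulIf c0); rewrite divfK //.
  transitivity (2 * 'C(r, v)%:R * ('C(n, v)%:R * 'C(n - v, j)%:R) * p ^+ 'C(r, 2)
                * p^-1 ^+ 'C(v, 2)); last by ring.
  rewrite -(natrM _ 'C(n, v)) (bin_mul_bin n vr) natrM.
  transitivity (2 * 'C(r, v)%:R ^+ 2 * ('C(n, r)%:R * p ^+ 'C(r, 2))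
                * p^-1 ^+ 'C(v, 2)); last by ring.
  by rewrite p_critical; field.
have x0 : 0 <= r%:R / n%:R :> R by rewrite divr_ge0 ?ler0n.
have pr : p ^+ r.-1 <= (r%:R / n%:R) ^+ 2.
  rewrite -[p]invrK -[r%:R / _]invf_div !exprVn lef_pV2 -?exprVn ?invp_exp_ge //;
  by rewrite posrE exprn_gt0 ?divr_gt0.
have p_le1 : p <= 1 by case/andP: p01 => _ /ltW.
have pv : p ^+ v <= r%:R / n%:R.
  rewrite -(@ler_pXn2r _ 2) ?nnegrE ?exprn_ge0 ?(ltW p_gt0) // -exprM.
  by apply: le_trans pr; apply: ler_wiXn2l; rewrite ?(ltW p_gt0) //; clear -rv r_gt1; lia.
have P2 : (p ^+ ('C(r, 2) - 'C(v, 2))) ^+ 2 <= ((r%:R / n%:R) ^+ 3) ^+ j.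
  rewrite -exprM mulnBl !double_bin2.
  have -> : (r * r.-1 - v * v.-1 = (r.-1 + v) * j)%N by rewrite /j; clear -vr r_gt1; nia.
  rewrite exprM lerXn2r ?nnegrE ?exprn_ge0 ?(ltW p_gt0) //.
  rewrite exprD [in leRHS]exprSr; apply: ler_pM => //; exact: exprn_ge0 (ltW p_gt0).
rewrite W [leLHS]exprMn [X in X * _ <= _]exprMn [X in X * _ * _ <= _]exprMn.
rewrite (_ : 2 ^+ 2 = 4 :> R); last by ring.
(* The estimates give r^5 / n; a spare factor r is inserted to share the base of the low range. *)
have -> : (r%:R ^+ 6 / n%:R) ^+ j =
   (r%:R ^+ j) ^+ 2 * (n%:R ^+ j) ^+ 2 * (r%:R * (r%:R / n%:R) ^+ 3) ^+ j :> R.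
  rewrite !(exprAC _ j) -!(exprMn j); congr (_ ^+ j).
  by field; rewrite gt_eqF.
rewrite 2![in leRHS]mulrA.
have r1 : 1 <= r%:R :> R by rewrite ler1n ltnW.
have p2 : 0 <= (p ^+ ('C(r, 2) - 'C(v, 2))) ^+ 2 by rewrite !exprn_ge0 // ltW.
apply: ler_pM => //; rewrite ?mulr_ge0 ?exprn_ge0 ?ler0n //; last first.
  apply: le_trans P2 _; apply: lerXn2r; rewrite ?nnegrE ?mulr_ge0 ?exprn_ge0 ?invr_ge0 ?ler0n //.
  by rewrite ler_peMl // exprn_ge0.
apply: ler_pM; rewrite ?mulr_ge0 ?exprn_ge0 ?ler0n //.
  apply: ler_pM; rewrite ?mulr_ge0 ?exprn_ge0 ?ler0n //.
  by apply: lerXn2r; rewrite ?nnegrE ?exprn_ge0 ?ler0n // -natrX ler_nat leq_bin_expn.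
apply: lerXn2r; rewrite ?nnegrE ?exprn_ge0 ?ler0n // -natrX ler_nat.
apply: leq_trans (leq_bin_expn _ _) _; case: (j) => // k.
by rewrite leq_exp2r // leq_subr.
Qed.

Let x_ge0 : 0 <= r%:R ^+ 6 / n%:R :> R.
Proof. by rewrite divr_ge0 ?exprn_ge0 ?ler0n. Qed.

Let x_small : (36 <= r)%N -> r%:R ^+ 6 / n%:R <= (1 / 4) ^+ 2 :> R.
Proof.
move=> r36; rewrite ler_pdivrMr //.
have : (16 * r ^ 6 <= n)%N := leq_trans (leq_expn2_sextic r36) (ltnW n_large).
by rewrite -(ler_nat R) natrM natrX; lra.
Qed.

Let weight_low_geometric v : (36 <= r)%N -> (0 < v)%N -> (v.*2 <= r)%N ->
  clique_weight n r p v <= 1 / 4 * (1 / 4) ^+ v.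
Proof.
move=> r36 v0 vr; suff : 4 * clique_weight n r p v <= (1 / 4) ^+ v by lra.
have q0 : 0 <= 1 / 4 :> R by lra.
rewrite -(@ler_pXn2r _ 2) ?nnegrE ?weight4_ge0 ?exprn_ge0 //.
apply: le_trans (clique_weight_low v0 vr) _.
by rewrite exprAC lerXn2r ?nnegrE ?exprn_ge0 ?x_small.
Qed.

Let weight_high_geometric v : (36 <= r)%N -> (v <= r)%N -> (r <= v.*2)%N ->
  clique_weight n r p v <= 1 / 2 * (1 / 4) ^+ (r - v).
Proof.
move=> r36 vr rv.
suff : 4 * clique_weight n r p v <= 2 * (1 / 4) ^+ (r - v) by lra.
have q0 : 0 <= 1 / 4 :> R by lra.
rewrite -(@ler_pXn2r _ 2) ?nnegrE ?weight4_ge0 ?(mulr_ge0 _ (exprn_ge0 _ q0)) //.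
apply: le_trans (clique_weight_high vr rv) _.
rewrite [leRHS]exprMn (_ : 2 ^+ 2 = 4 :> R); last by ring.
by rewrite ler_pM2l // exprAC lerXn2r ?nnegrE ?exprn_ge0 ?x_small.
Qed.

Let geometric_sum k : \sum_(v < k) (1 / 4) ^+ v = 4 / 3 * (1 - (1 / 4) ^+ k) :> R.
Proof.
elim: k => [|k IH]; first by rewrite big_ord0 expr0; ring.
by rewrite big_ord_recr /= IH exprS; field.
Qed.

(** For bounded r a crude bound suffices: r^6 / n <= 36^6, raised to an exponent at most 36. *)
Let weight_small v : (r < 36)%N -> (0 < v <= r)%N ->
  clique_weight n r p v <= (36 ^+ 6) ^+ 36.
Proof.
move=> r36 /andP[v0 vr]; set B : R := 36 ^+ 6.
have B1 : 1 <= B by rewrite exprn_ege1 // ler1n.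
have xB : r%:R ^+ 6 / n%:R <= B.
  apply: (@le_trans _ _ (r%:R ^+ 6)).
    by rewrite ler_pdivrMr // ler_peMr ?exprn_ge0 ?ler0n // ler1n.
  by rewrite lerXn2r ?nnegrE ?ler0n // ler_nat ltnW.
have xk k : (k <= r)%N -> (r%:R ^+ 6 / n%:R) ^+ k <= B ^+ 36.
  move=> kr; apply: (@le_trans _ _ (B ^+ k)).
    by apply: lerXn2r; rewrite ?nnegrE // (le_trans ler01).
  by apply: ler_weXn2l => //; clear -kr r36; lia.
have D1 : 1 <= B ^+ 36 by rewrite exprn_ege1.
suff h : (4 * clique_weight n r p v) ^+ 2 <= (4 * B ^+ 36) ^+ 2.
  have D0 : 0 <= 4 * B ^+ 36 by rewrite mulr_ge0 // (le_trans ler01).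
  by move: h; rewrite ler_pXn2r ?nnegrE ?weight4_ge0 // ler_pM2l.
have D4 : 4 * B ^+ 36 <= (4 * B ^+ 36) ^+ 2.
  by move: (B ^+ 36) D1 => D D1; nra.
apply: le_trans D4; have [rv|/ltnW rv] := leqP r v.*2.
  apply: le_trans (clique_weight_high vr rv) _.
  by rewrite ler_pM2l // xk // leq_subr.
apply: le_trans (clique_weight_low v0 rv) (le_trans (xk v vr) _).
by rewrite ler_peMl ?ler1n // (le_trans ler01).
Qed.

(** For r < 36 the range is empty, since v >= 2 forces 18 v >= 36. Otherwise the terms decay
    geometrically from v = 2 on, with total at most (4/3 - 1 - 1/4) / 4 = 1/48. *)
Lemma sum_clique_weight_low :
  \sum_(v < r.+1 | (1 < v)%N && (18 * v < r)%N) clique_weight n r p v <= 1 / 48.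
Proof.
have [r36|r36] := ltnP r 36.
  rewrite big_pred0; first by lra.
  by move=> v; apply/negbTE; rewrite negb_and -!leqNgt; clear -r36; lia.
apply: (@le_trans _ _ (\sum_(v < r.+1 | (1 < v)%N) 1 / 4 * (1 / 4) ^+ v)).
  rewrite [leRHS](bigID (fun v : 'I_r.+1 => (18 * v < r)%N)) /= ler_wpDr //.
    by apply: sumr_ge0 => v _; rewrite mulr_ge0 ?exprn_ge0 //; lra.
  by apply: ler_sum => v /andP[v1 v18]; apply: weight_low_geometric => //; clear -v1 v18; lia.
have := geometric_sum r.+1.
have : 0 <= (1 / 4) ^+ r.+1 :> R by rewrite exprn_ge0 //; lra.
rewrite -mulr_sumr; case: (r) r_gt1 => [|[|k]] // _.
rewrite [X in _ -> _ -> _ * X <= _]big_mkcond /= 2!big_ord_recl [in X in _ -> _ -> X]big_ord_recl.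
rewrite [in X in _ -> _ -> X]big_ord_recl /= expr0.
rewrite -[bump 0 0]/1%N expr1.
move: (\sum_(i < k.+1) _) ((1 / 4) ^+ k.+3) => s q; lra.
Qed.

Lemma sum_clique_weight :
  \sum_(v < r.+1 | (1 < v)%N) clique_weight n r p v <= 36 * (36 ^+ 6) ^+ 36.
Proof.
have D1 : 1 <= (36 ^+ 6) ^+ 36 :> R by rewrite !exprn_ege1 // ler1n.
have [r36|r36] := ltnP r 36.
  apply: (@le_trans _ _ (\sum_(v < r.+1) (36 ^+ 6) ^+ 36)).
    rewrite big_mkcond; apply: ler_sum => v _; case: ifP => v1; last first.
      by apply: le_trans ler01 D1.
    by apply: weight_small => //; have := ltn_ord v; clear -v1; lia.
  rewrite sumr_const card_ord -[leLHS]mulr_natl ler_wpM2r ?ler_nat //.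
  by apply: le_trans ler01 D1.
(* The first term dominates the weights with 2 v <= r, the second those with 2 v >= r; reversing the
   index makes both sums the same geometric one. *)
pose g v : R := 1 / 2 * ((1 / 4) ^+ v + (1 / 4) ^+ (r - v)).
have q0 k : 0 <= (1 / 4) ^+ k :> R by rewrite exprn_ge0 //; lra.
apply: (@le_trans _ _ (\sum_(v < r.+1) g v)).
  rewrite big_mkcond; apply: ler_sum => v _; have := q0 v; have := q0 (r - v)%N.
  case: ifP => v1; last by rewrite /g; lra.
  have vr : (v <= r)%N by rewrite -ltnS.
  have [rv|/ltnW rv] := leqP r v.*2.
    by have := weight_high_geometric r36 vr rv; rewrite /g; lra.
  by have := weight_low_geometric r36 (ltnW v1) rv; rewrite /g; lra.
rewrite /g -mulr_sumr big_split /=.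
rewrite [X in _ * (_ + X)](reindex_inj rev_ord_inj) /=.
rewrite [X in _ * (_ + X)](eq_bigr (fun v : 'I_r.+1 => (1 / 4) ^+ v)); last first.
  by move=> v _; congr (_ ^+ _); have := ltn_ord v; clear; lia.
rewrite geometric_sum; have := q0 r.+1.
move: D1; move: ((36 ^+ 6) ^+ 36 : R) ((1 / 4) ^+ r.+1 : R) => D q D1 q_ge0; lra.
Qed.

End CliqueWeights.
(** * Cliques and vertex permutations *)

Lemma card_supersets (T : finType) (V : {set T}) (r : nat) : (#|V| <= r)%N ->
  #|[set W : {set T} | (V \subset W) && (#|W| == r)]| = 'C(#|T| - #|V|, r - #|V|).
Proof.
move=> Vr; rewrite -(cardsC V) addKn -cards_draws.
rewrite -[RHS](@card_in_imset _ _ (fun W : {set T} => V :|: W)); last first.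
  move=> W1 W2 /[!inE] /andP[+ _] /andP[+ _].
  have h (W : {set T}) : W \subset ~: V -> (V :|: W) :\: V = W.
    move=> WV; rewrite setDUl setDv set0U; apply/setDidPl.
    by rewrite disjoints_subset.
  by move=> /h e1 /h e2 e; rewrite -e1 -e2 e.
apply: eq_card => W; rewrite inE; apply/andP/imsetP => [[VW /eqP Wr]|[W' + ->]].
  exists (W :\: V); last by rewrite -{1}(setIidPr VW) setID.
  by rewrite inE subsetDr cardsD (setIidPr VW) Wr eqxx.
rewrite inE => /andP[dis /eqP cW]; split; first exact: subsetUl.
rewrite cardsU cW (_ : V :&: W' = set0) ?cards0 ?subn0; first by rewrite subnKC.
by apply/eqP; rewrite setI_eq0 disjoint_sym disjoints_subset.
Qed.

(** List A before its complement and B before its complement; matching the two lists position by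
    position sends A to B. *)
Lemma exists_perm_imset (T : finType) (A B : {set T}) :
  #|A| = #|B| -> exists s : {perm T}, s @: A = B.
Proof.
(* [nth] takes a default element, so the empty type is treated apart. *)
move=> AB; have [x0 _|T0] := pickP (fun _ : T => true); last first.
  by exists 1%g; apply/setP => x; have := T0 x.
pose l (C : {set T}) := enum C ++ enum (~: C).
have l_uniq C : uniq (l C).
  rewrite cat_uniq !enum_uniq andbT /=; apply/hasPn => x.
  by rewrite !mem_enum inE.
have l_mem C x : x \in l C by rewrite mem_cat !mem_enum inE orbN.
have l_size C : size (l C) = #|T|.
  by rewrite size_cat -!cardE cardsC.
pose s x := nth x0 (l B) (index x (l A)).
have s_inj : injective s.
  move=> x y /eqP; rewrite nth_uniq ?l_uniq //; last 2 first.
  - by rewrite l_size -(l_size A) index_mem.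
  - by rewrite l_size -(l_size A) index_mem.
  by move=> /eqP /(congr1 (nth x0 (l A))); rewrite !nth_index.
exists (perm s_inj); apply/eqP; rewrite eqEcard card_imset ?AB ?leqnn ?andbT; last exact: perm_inj.
apply/subsetP => _ /imsetP[x xA ->]; rewrite permE /s.
have xi : (index x (l A) < #|B|)%N.
  by rewrite index_cat mem_enum xA -AB cardE index_mem mem_enum.
by rewrite nth_cat -cardE xi -mem_enum mem_nth // -cardE.
Qed.

Section CliqueEdges.
Variable n : nat.
Implicit Types (W : {set 'I_n}) (S G : {set edge n}) (s : {perm 'I_n}).

Definition clique_edges W : {set edge n} := [set e : edge n | val e \subset W].

Definition covered S : {set 'I_n} := \bigcup_(e in S) val e.

Lemma card_clique_edges W : #|clique_edges W| = 'C(#|W|, 2).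
Proof.
rewrite -cards_draws -(card_imset _ val_inj); apply: eq_card => A; rewrite !inE.
apply/imsetP/andP => [[e + ->]|[AW A2]]; first by rewrite inE (valP e).
by exists (Sub A A2 : edge n); rewrite ?inE SubK.
Qed.

Lemma sub_clique_edges S W : (S \subset clique_edges W) = (covered S \subset W).
Proof.
apply/subsetP/bigcupsP => h e eS; first by have := h e eS; rewrite inE.
by rewrite inE h.
Qed.

Lemma covered_eq0 S : (covered S == set0) = (S == set0).
Proof.
rewrite -subset0 -sub_clique_edges (_ : clique_edges set0 = set0) ?subset0 //.
by apply/eqP; rewrite -cards_eq0 card_clique_edges cards0.
Qed.

Lemma card_covered_gt1 S : S != set0 -> (1 < #|covered S|)%N.
Proof.
case/set0Pn => e eS; rewrite -(eqP (valP e)).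
by apply: subset_leq_card; apply: bigcup_sup eS.
Qed.

(** Distinct vertices are always adjacent in the complete graph, so an induced copy amounts to a
    clique on the image of the embedding. On the diagonal both adjacencies fail, as an edge has two
    elements. *)
Lemma clique_indicatorP r G :
  reflect (exists2 W : {set 'I_n}, #|W| = r & clique_edges W \subset G)
          (clique_indicator r G).
Proof.
have adjE m (H : {set edge m}) u v :
  adj H u v = [exists e in H, val e == [set u; v]].
  apply/imsetP/exists_inP => [[e eH ->]|[e eH /eqP <-]]; first by exists e.
  by exists e.
have completeE (u v : 'I_r) : adj (complete_graph r) u v = (u != v).
  rewrite adjE; apply/exists_inP/idP => [[e _ /eqP uv]|uv].
    by have := eqP (valP e); rewrite uv cards2; case: (u != v).
  have uv2 : #|[set u; v]| == 2 by rewrite cards2 uv.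
  by exists (Sub [set u; v] uv2 : edge r); rewrite ?inE // SubK.
apply: (iffP existsP) => [[phi /andP[/injectiveP phi_inj /forallP phiG]]|[W Wr WG]].
  exists (phi @: [set: 'I_r]); first by rewrite card_imset // cardsT card_ord.
  apply/subsetP => e; rewrite inE => /subsetP eW.
  have /cards2P[a [b [ab eab]]] := valP e.
  have /imsetP[u _ au] : a \in phi @: [set: 'I_r] by apply: eW; rewrite eab !inE eqxx.
  have /imsetP[v _ bv] : b \in phi @: [set: 'I_r] by apply: eW; rewrite eab !inE eqxx orbT.
  have := eqP (forallP (phiG u) v); rewrite completeE adjE -au -bv.
  rewrite (_ : u != v); last by apply: contraNneq ab => uv; rewrite au bv uv.
  by case/exists_inP => e' e'G; rewrite -eab => /eqP /val_inj <-.
have cW : #|W| = #|'I_r| by rewrite card_ord.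
pose phi := [ffun u : 'I_r => enum_val (cast_ord (esym Wr) u)].
have phiW u : phi u \in W by rewrite ffunE; apply: enum_valP.
have phi_inj : injective phi.
  by move=> u v; rewrite !ffunE => /enum_val_inj /cast_ord_inj.
exists phi; apply/andP; split; first exact/injectiveP.
apply/forallP => u; apply/forallP => v; rewrite completeE adjE; apply/eqP.
apply/exists_inP/idP => [[e _ /eqP uv]|uv].
  have := eqP (valP e); rewrite uv cards2; apply: contra_eqN => /eqP ->.
  by rewrite eqxx.
have uv2 : #|[set phi u; phi v]| == 2 by rewrite cards2 (inj_eq phi_inj) uv.
exists (Sub [set phi u; phi v] uv2 : edge n); rewrite ?SubK //.
apply: (subsetP WG); rewrite inE SubK; apply/subsetP => w.
by rewrite !inE => /orP[] /eqP ->.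
Qed.

Lemma edge_perm_subproof s (e : edge n) : #|s @: val e| == 2.
Proof. by rewrite card_imset ?(valP e) //; apply: perm_inj. Qed.

Definition edge_perm s (e : edge n) : edge n := Sub (s @: val e) (edge_perm_subproof s e).

Lemma val_edge_perm s e : val (edge_perm s e) = s @: val e.
Proof. by []. Qed.

Lemma edge_permK s : cancel (edge_perm s) (edge_perm s^-1%g).
Proof.
move=> e; apply: val_inj; rewrite !val_edge_perm -imset_comp.
by rewrite (eq_imset _ (g := id)) ?imset_id // => i; rewrite /= permK.
Qed.

Lemma edge_perm_inj s : injective (edge_perm s).
Proof. exact: can_inj (edge_permK s). Qed.

Lemma covered_edge_perm s S : covered (edge_perm s @: S) = s @: covered S.
Proof.
rewrite /covered big_imset /=; last by move=> ? ? _ _; apply: edge_perm_inj.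
apply/setP => i; apply/bigcupP/imsetP => [[e eS]|[j /bigcupP[e eS je] ->]].
  by case/imsetP => j je ->; exists j => //; apply/bigcupP; exists e.
by exists e => //; apply: imset_f.
Qed.

Lemma clique_indicator_edge_perm r s G :
  clique_indicator r (edge_perm s @: G) = clique_indicator r G.
Proof.
have imp s' G' : clique_indicator r G' -> clique_indicator r (edge_perm s' @: G').
  case/clique_indicatorP => W Wr WG; apply/clique_indicatorP; exists (s' @: W).
    by rewrite card_imset //; apply: perm_inj.
  apply/subsetP => e; rewrite inE => eW.
  rewrite -[e](edge_permK s'^-1%g) invgK; apply/imset_f/(subsetP WG).
  rewrite inE val_edge_perm; apply/subsetP => _ /imsetP[i ie ->].
  by have /imsetP[j jW ->] := subsetP eW i ie; rewrite permK.
apply/idP/idP; last exact: imp.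
move/(imp s^-1%g); rewrite -imset_comp (eq_imset _ (g := id)) ?imset_id //.
exact: edge_permK.
Qed.

End CliqueEdges.
(** * Spectrum of the clique indicator *)

Section CliqueSpectrum.
Variables (R : realType) (n r : nat) (p : R).
Hypothesis p01 : 0 < p < 1.

Local Notation f := (@clique_indicator r n).
Local Notation fhat := (fourier_coef p f).

Lemma sum_fourier_coef_clique_le1 : \sum_S fhat S ^+ 2 <= 1.
Proof.
apply: le_trans (bessel_inequality p01 _) _; rewrite -[leRHS](cube_E1 (edge n) p).
apply: ler_sum => x _; rewrite ler_wpM2l ?cube_measure_ge0 //.
by case: (f x); rewrite ?ler01.
Qed.

(* The coefficient at S is shared by all the images of S under permutations of
   the vertices, which cover all the sets of #|covered S| vertices. *)
Lemma fourier_coef_clique_sqr_bin (S : {set edge n}) :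
  fhat S ^+ 2 * 'C(n, #|covered S|)%:R <= 1.
Proof.
apply: le_trans sum_fourier_coef_clique_le1.
rewrite [leRHS](partition_big (@covered n) xpredT) //=.
have -> : 'C(n, #|covered S|)
    = #|[set V : {set 'I_n} | #|V| == #|covered S|]|.
  by rewrite card_draws card_ord.
rewrite mulr_natr -sumr_const big_mkcond; apply: ler_sum => V _.
case: ifPn => [|_]; last by apply: sumr_ge0 => U _; apply: sqr_ge0.
rewrite inE => /eqP /esym /exists_perm_imset[s sV].
rewrite (bigD1 (edge_perm s @: S)) /=; last by rewrite covered_edge_perm sV.
rewrite fourier_coef_imset ?lerDl //; last 2 first.
- exact: edge_perm_inj.
- exact: clique_indicator_edge_perm.
by apply: sumr_ge0 => U _; apply: sqr_ge0.
Qed.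

Lemma expected_clique_count :
  \sum_(W : {set 'I_n} | #|W| == r) cube_E p (fun x => (clique_edges W \subset x)%:R)
    = 'C(n, r)%:R * p ^+ 'C(r, 2).
Proof.
rewrite (eq_bigr (fun=> p ^+ 'C(r, 2))); last first.
  by move=> W /eqP Wr; rewrite cube_E_subset_indicator // card_clique_edges Wr.
rewrite sumr_const -cardsE card_draws card_ord.
by rewrite mulr_natl.
Qed.

(** First moment bound: pointwise, the indicator is at most the number of cliques. *)
Lemma cube_E_clique_indicator_le :
  cube_E p (fun x => (f x)%:R) <= 'C(n, r)%:R * p ^+ 'C(r, 2).
Proof.
rewrite -expected_clique_count /cube_E exchange_big; apply: ler_sum => x _ /=.
rewrite -mulr_sumr ler_wpM2l ?cube_measure_ge0 //.
case: clique_indicatorP => [[W /eqP Wr Wx]|_].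
  by rewrite (bigD1 W) //= Wx lerDl sumr_ge0.
by rewrite sumr_ge0.
Qed.

(* The Fourier coefficient at S of the number of r-cliques, read off
   subset_indicator_expansion. *)
Definition clique_count_coef (S : {set edge n}) : R :=
  #|[set W : {set 'I_n} | (covered S \subset W) && (#|W| == r)]|%:R
  * p ^+ 'C(r, 2) * (- Num.sqrt ((1 - p) / p)) ^+ #|S|.

Lemma clique_count_coefE (S : {set edge n}) : (#|covered S| <= r)%N ->
  clique_count_coef S = 'C(n - #|covered S|, r - #|covered S|)%:R
    * p ^+ 'C(r, 2) * (- Num.sqrt ((1 - p) / p)) ^+ #|S|.
Proof. by move=> Sr; rewrite /clique_count_coef card_supersets // card_ord. Qed.

(** This is E[f X] = E[X] for the clique count X: f is 1 wherever some clique is present. Expanding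
    each clique and exchanging sums, S occurs once for every r-set containing [covered S]. *)
Lemma sum_clique_count_coef_fourier :
  \sum_S clique_count_coef S * fhat S = 'C(n, r)%:R * p ^+ 'C(r, 2).
Proof.
rewrite -expected_clique_count.
transitivity (\sum_(W : {set 'I_n} | #|W| == r)
   cube_E p (fun x => (f x)%:R * (clique_edges W \subset x)%:R)); last first.
  apply: eq_bigr => W /eqP Wr; apply: eq_bigr => x _; congr (_ * _).
  case: (boolP (clique_edges W \subset x)) => Wx; last by rewrite mulr0.
  by rewrite mulr1; case: clique_indicatorP => // - []; exists W.
under [RHS]eq_bigr => W /eqP Wr.
  rewrite cube_E_mul_subset_indicator // card_clique_edges Wr.
over.
rewrite (exchange_big_dep xpredT) //=; apply: eq_bigr => S _.
rewrite sumr_const /clique_count_coef -[RHS]mulr_natl !mulrA.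
congr (_ * _ * _ * _); congr (_%:R); apply: eq_card => W.
by rewrite inE unfold_in sub_clique_edges andbC.
Qed.

(** The sets S are grouped by V = [covered S], on which the count of r-sets depends. Each group is
    enlarged to all subsets of [clique_edges V], where [sum_subsets_sqr_weight] applies; there are
    'C(n, v) sets V of size v. *)
Lemma sum_clique_count_coef_sqr (Q : pred nat) : (forall v, Q v -> (v <= r)%N) ->
  \sum_(S : {set edge n} | Q #|covered S|) clique_count_coef S ^+ 2
    <= \sum_(v < r.+1 | Q v) clique_weight n r p v.
Proof.
move=> Qr; pose h v := ('C(n - v, r - v)%:R * p ^+ 'C(r, 2)) ^+ 2 * p^-1 ^+ 'C(v, 2).
apply: (@le_trans _ _ (\sum_(V : {set 'I_n} | Q #|V|) h #|V|)).
  rewrite (partition_big (@covered n) (fun V => Q #|V|)) //=.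
  apply: ler_sum => V QV; rewrite /h -card_clique_edges -sum_subsets_sqr_weight // mulr_sumr.
  rewrite [leRHS](bigID (fun S : {set edge n} => covered S == V)) /= ler_wpDr //.
    by apply: sumr_ge0 => S _; rewrite mulr_ge0 ?sqr_ge0.
  rewrite big_mkcond [leRHS]big_mkcond /=; apply: ler_sum => S _.
  rewrite sub_clique_edges; case: eqP => [SV|_]; last by rewrite !andbF.
  by rewrite SV QV subxx /= clique_count_coefE SV ?Qr // exprMn.
(* [Qr] keeps all sizes at most r, so [inord] never falls back on its default. *)
rewrite (partition_big (fun V : {set 'I_n} => inord #|V|) (fun v : 'I_r.+1 => Q v)) /=; last first.
  by move=> V QV; rewrite inordK // ltnS Qr.
apply: ler_sum => v Qv; rewrite /clique_weight -mulrA -/(h v).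
rewrite (eq_big (fun V : {set 'I_n} => #|V| == v) (fun=> h v)).
- by rewrite sumr_const -cardsE card_draws card_ord mulr_natl.
- move=> V; apply/andP/eqP => [[QV /eqP <-]|Vv]; first by rewrite inordK // ltnS Qr.
  by rewrite Vv Qv -(inj_eq val_inj) /= inordK.
by move=> V /andP[QV /eqP <-]; rewrite inordK // ltnS Qr.
Qed.

Lemma total_influence_clique_indicator :
  p * total_influence p f
    <= 'C(r, 2)%:R * ('C(n, r)%:R * p ^+ 'C(r, 2)).
Proof.
apply: (@le_trans _ _ ('C(r, 2)%:R * cube_E p (fun x => (f x)%:R))).
  apply: total_influence_certificate => // x /clique_indicatorP[W Wr Wx].
  exists (clique_edges W); rewrite card_clique_edges Wr; split => // y Wy.
  by apply/clique_indicatorP; exists W.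
by rewrite ler_wpM2l ?ler0n // cube_E_clique_indicator_le.
Qed.

End CliqueSpectrum.

(** * Spectral mass on spread sets and the entropy bound *)

Section EntropyLowerBound.
Variables (R : realType) (n r : nat) (p : R).
Hypothesis p01 : 0 < p < 1.
Hypothesis r_gt1 : (1 < r)%N.
Hypothesis n_large : (2 ^ r < n)%N.
Hypothesis p_critical : 'C(n, r)%:R * p ^+ 'C(r, 2) = 1 / 2.

Local Notation fhat := (fourier_coef p (@clique_indicator r n)).
Local Notation a := (@clique_count_coef R n r p).
Local Notation C := (36 * (36 ^+ 6) ^+ 36 : R).

(* If r <= 36 every v between 2 and r is spread; otherwise the sets S which are
   not spread carry only 1/48 of the squared norm of the number of cliques. *)
Definition spread v := [&& 1 < v, r <= 18 * v & v <= r]%N.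

Let C_gt0 : 0 < C. Proof. by rewrite mulr_gt0 ?exprn_gt0 ?ltr0n. Qed.

Let mean_le : cube_E p (fun x => (@clique_indicator r n x)%:R) <= 1 / 2.
Proof. by rewrite -p_critical cube_E_clique_indicator_le. Qed.

Let sum_fhat_le : \sum_S fhat S ^+ 2 <= 1 / 2.
Proof. exact: le_trans (bessel_inequality p01 _) mean_le. Qed.

Let coef_set0 : a set0 * fhat set0 <= 1 / 4.
Proof.
have c0 : covered (set0 : {set edge n}) = set0 by apply/eqP; rewrite covered_eq0.
rewrite clique_count_coefE ?c0 !cards0 // !subn0 p_critical expr0 mulr1.
rewrite (_ : fhat set0 = cube_E p (fun x => (@clique_indicator r n x)%:R)).
  by move: mean_le; lra.
apply: eq_bigr => x _.
by rewrite /fourier_char set0I set0D cards0 !expr0 !mulr1.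
Qed.

(* AM-GM, with weights chosen so that the terms in a contribute at most 1/24 and
   1/16 to the sum of all the products, which is 1/2. *)
Let coef_le (S : {set edge n}) : a S * fhat S <=
  (if S == set0 then 1 / 4 else 0)
  + (if (1 < #|covered S|)%N && (18 * #|covered S| < r)%N
     then 2 * a S ^+ 2 + 1 / 8 * fhat S ^+ 2 else 0)
  + (if spread #|covered S| then (16 * C)^-1 * a S ^+ 2 + 4 * C * fhat S ^+ 2 else 0).
Proof.
have amgm (t x y : R) : 0 < t -> x * y <= (16 * t)^-1 * x ^+ 2 + 4 * t * y ^+ 2.
  move=> t0; rewrite -subr_ge0.
  have -> : (16 * t)^-1 * x ^+ 2 + 4 * t * y ^+ 2 - x * y
     = (x - 8 * t * y) ^+ 2 * (16 * t)^-1 by field; rewrite gt_eqF.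
  by rewrite mulr_ge0 ?sqr_ge0 // invr_ge0 mulr_ge0 // ltW.
have [->|S0] := eqVneq S set0.
  have -> : covered (set0 : {set edge n}) = set0 by apply/eqP; rewrite covered_eq0.
  by rewrite /spread cards0 /= !addr0.
have v1 := card_covered_gt1 S0; rewrite /spread v1 /= add0r.
case: (leqP r (18 * #|covered S|)) => v18 /=; last first.
  rewrite addr0; apply: le_trans (amgm (1 / 32) _ _ _) _; first by lra.
  lra.
rewrite add0r; case: leqP => vr; first exact: amgm.
rewrite /clique_count_coef (_ : #|_| = 0%N) ?mul0r //; apply: eq_card0 => W.
rewrite !inE; apply/negbTE/negP => /andP[/subset_leq_card SW /eqP Wr].
by move: SW; rewrite Wr leqNgt vr.
Qed.

(** Summing [coef_le] over S gives 1/2 <= 1/4 + 1/24 + 1/16 + 1/16 + 4 C F, where F is the spread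
    mass; hence 4 C F >= 1/12. *)
Lemma spectral_mass_spread :
  (48 * C)^-1 <= \sum_(S : {set edge n} | spread #|covered S|) fhat S ^+ 2.
Proof.
have low : \sum_(S : {set edge n} | (1 < #|covered S|)%N && (18 * #|covered S| < r)%N)
     a S ^+ 2 <= 1 / 48.
  apply: le_trans (sum_clique_weight_low p01 r_gt1 n_large p_critical).
  apply: (@sum_clique_count_coef_sqr _ _ _ _ p01 (fun v => (1 < v)%N && (18 * v < r)%N)).
  by move=> v /andP[_]; clear; lia.
have high : \sum_(S : {set edge n} | spread #|covered S|) a S ^+ 2 <= C.
  apply: le_trans (sum_clique_weight p01 r_gt1 n_large p_critical).
  apply: le_trans (@sum_clique_count_coef_sqr _ _ _ _ p01 spread _) _.
    by move=> v /and3P[].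
  rewrite big_mkcond [leRHS]big_mkcond; apply: ler_sum => v _; rewrite /spread.
  by case: ifP => [/andP[-> _] //|_]; case: ifP => // _; exact: clique_weight_ge0.
have lowf : \sum_(S : {set edge n} | (1 < #|covered S|)%N && (18 * #|covered S| < r)%N)
     fhat S ^+ 2 <= 1 / 2.
  apply: le_trans sum_fhat_le; rewrite big_mkcond; apply: ler_sum => S _.
  by case: ifP => // _; apply: sqr_ge0.
have := ler_sum (index_enum _) (fun S (_ : true) => coef_le S).
rewrite sum_clique_count_coef_fourier // p_critical !big_split /=.
rewrite -!big_mkcond big_pred1_eq !big_split /= -!mulr_sumr.
set A1 := \sum_(_ | _) _ in low *; set F1 := \sum_(_ | _) _ in lowf *.
set A2 := \sum_(_ | _) _ in high *; set F2 := \sum_(_ | _) _.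
move=> h; have hA2 : (16 * C)^-1 * A2 <= 1 / 16.
  by rewrite ler_pdivrMl ?mulr_gt0 // (le_trans high) //; lra.
rewrite -[_^-1]div1r ler_pdivrMr ?mulr_gt0 //.
have := C_gt0; move: (C) h hA2 => c h hA2 c0; lra.
Qed.

Let sqr_leq_n v : (v <= r)%N -> (v ^ 2 <= n)%N.
Proof.
move=> vr; apply: (@leq_trans (r ^ 2)); first by rewrite leq_exp2r.
exact: leq_trans (leq_expn2_sqr r_gt1) n_large.
Qed.

(** From n^v <= 'C(n, v) v^v and v^2 <= n one gets n^v <= 'C(n, v)^2. Then 2 'C(n, r) <= n^r <=
    n^(18 v) <= 'C(n, v)^36. *)
Lemma spread_leq_bin v : spread v -> (2 * 'C(n, r) <= 'C(n, v) ^ 36)%N.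
Proof.
case/and3P => v1 v18 vr; have n0 : (0 < n)%N by exact: leq_ltn_trans n_large.
have nv : (v <= n)%N.
  by apply: leq_trans (sqr_leq_n vr); rewrite -mulnn leq_pmulr // ltnW.
have h : (n ^ v <= 'C(n, v) ^ 2)%N.
  rewrite -(@leq_pmul2r (n ^ v)) ?expn_gt0 ?n0 //.
  apply: (@leq_trans ('C(n, v) ^ 2 * (v ^ 2) ^ v)).
    by rewrite (expnAC v) -(expnMn _ _ 2) [leqLHS]mulnn leq_exp2r // expn_leq_bin.
  by rewrite leq_mul2l leq_exp2r ?sqr_leq_n ?orbT // ltnW.
apply: leq_trans (double_bin_leq_expn _ r_gt1) _.
apply: (@leq_trans ((n ^ v) ^ 18)); first by rewrite -expnM mulnC leq_pexp2l.
by rewrite (expnM _ 2 18) leq_exp2r.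
Qed.

Let ln2_gt0 : 0 < ln 2 :> R. Proof. by rewrite ln_gt0 // ltr1n. Qed.

(** Symmetry bounds the squared coefficient by 1 / 'C(n, v), and 'C(n, v)^36 >= 2 'C(n, r) =
    p^-'C(r, 2); take logarithms. *)
Lemma log2_fourier_coef_spread (S : {set edge n}) :
    spread #|covered S| -> 0 < fhat S ^+ 2 ->
  'C(r, 2)%:R * log2 (1 / p) / 36 <= log2 (1 / fhat S ^+ 2).
Proof.
move=> Ss c_gt0; have [p_gt0 _] := andP p01.
have bin0 : 0 < 'C(n, #|covered S|)%:R :> R.
  rewrite ltr0n; have := spread_leq_bin Ss; case: 'C(n, #|covered S|) => //.
  rewrite exp0n // leqn0 muln_eq0 /= => /eqP Cnr; move: p_critical.
  by rewrite Cnr mul0r; lra.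
rewrite /log2 mulrA mulrAC ler_pM2r ?invr_gt0 // !div1r.
apply: (@le_trans _ _ (ln 'C(n, #|covered S|)%:R)); last first.
  rewrite ler_ln ?posrE ?invr_gt0 // -[leRHS]mul1r ler_pdivlMr // mulrC.
  exact: fourier_coef_clique_sqr_bin.
rewrite ler_pdivrMr // mulr_natl mulr_natr -!lnXn ?invr_gt0 //.
rewrite ler_ln ?posrE ?exprn_gt0 ?invr_gt0 // (invp_exp_critical p01 p_critical).
by rewrite -natrX -natrM ler_nat spread_leq_bin.
Qed.

Lemma spectral_entropy_clique_ge :
  (48 * C)^-1 * ('C(r, 2)%:R * log2 (1 / p) / 36)
    <= spectral_entropy p (@clique_indicator r n).
Proof.
set L := _ / 36; have L0 : 0 <= L.
  rewrite divr_ge0 // mulr_ge0 ?ler0n // divr_ge0 // ?ltW // ?ln_gt0 //.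
  by case/andP: p01 => p0 p1; rewrite div1r invf_gt1.
apply: (@le_trans _ _ (\sum_(S : {set edge n} | spread #|covered S|) fhat S ^+ 2 * L)).
  by rewrite -mulr_suml ler_wpM2r // spectral_mass_spread.
rewrite big_mkcond; apply: ler_sum => S _.
have [c0|c_neq0] := eqVneq (fhat S ^+ 2) 0.
  by rewrite c0 !mul0r if_same.
have c_gt0 : 0 < fhat S ^+ 2 by rewrite lt0r c_neq0 sqr_ge0.
case: ifP => Ss; first by rewrite ler_pM2l // log2_fourier_coef_spread.
(* Terms outside the spread range are nonnegative, because every squared coefficient is at most
   1. *)
rewrite mulr_ge0 ?sqr_ge0 // divr_ge0 ?(ltW ln2_gt0) // ln_ge0 // div1r.
rewrite invf_ge1 //; apply: le_trans (sum_fourier_coef_clique_le1 n r p01).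
by rewrite [leRHS](bigD1 S) //= lerDl; apply: sumr_ge0 => U _; apply: sqr_ge0.
Qed.

End EntropyLowerBound.

Theorem proposition2p4 (R : realType) :
  exists2 c : R, 0 < c &
    forall (n r : nat) (p0 : R),
      r%:R < log2 (n%:R : R) ->
      0 < p0 < 1 ->
      'C(n, r)%:R * p0 ^+ 'C(r, 2) = 1 / 2 ->
      spectral_entropy p0 (@clique_indicator r n)
        >= c * (p0 * log2 (1 / p0)) * total_influence p0 (@clique_indicator r n).
Proof.
pose C : R := 36 * (36 ^+ 6) ^+ 36.
have C_gt0 : 0 < C by rewrite mulr_gt0 ?exprn_gt0 ?ltr0n.
(* 864 = 48 * 36 / 2: the mass constant, the loss in the logarithm, and E[X] = 1/2 in the influence
   bound. *)
exists (864 * C)^-1; first by rewrite invr_gt0 mulr_gt0.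
move=> n r p r_small p01 p_critical; have [p_gt0 p_lt1] := andP p01.
have ln2_gt0 : 0 < ln 2 :> R by rewrite ln_gt0 // ltr1n.
(* At n = 0 the convention ln 0 = 0 makes the hypothesis read r < 0. *)
have n_gt0 : (0 < n)%N.
  case: n r_small {p_critical} => //.
  by rewrite /log2 ln0 // mul0r ltNge ler0n.
have n_large : (2 ^ r < n)%N.
  move: r_small; rewrite /log2 ltr_pdivlMr // mulr_natl -lnXn //.
  rewrite ltr_ln ?posrE ?exprn_gt0 ?ltr0n //.
  by rewrite -natrX ltr_nat.
(* Criticality would read 1 = 1/2 for r = 0 and n = 1/2 for r = 1. *)
have r_gt1 : (1 < r)%N.
  case: r p_critical {r_small n_large} => [|[|r]] //.
    by rewrite bin0 bin_small // expr0; lra.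
  rewrite bin1 bin_small // expr0 mulr1 => n_half.
  have : (n * 2)%N%:R = 1%N%:R :> R by rewrite natrM n_half; field.
  by move/eqP; rewrite eqr_nat; case: (n) => [|[|k]].
apply: le_trans (spectral_entropy_clique_ge p01 r_gt1 n_large p_critical).
rewrite -/C; have := total_influence_clique_indicator n r p01; rewrite p_critical.
set I := total_influence _ _; set m := 'C(r, 2)%:R => pI.
have l_ge0 : 0 <= log2 (1 / p).
  by rewrite divr_ge0 ?(ltW ln2_gt0) // ln_ge0 // div1r invf_ge1 // ltW.
have -> : (864 * C)^-1 * (p * log2 (1 / p)) * I
    = (864 * C)^-1 * log2 (1 / p) * (p * I) by ring.
have -> : (48 * C)^-1 * (m * log2 (1 / p) / 36)
    = (864 * C)^-1 * log2 (1 / p) * (m * (1 / 2)).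
  by field; rewrite gt_eqF.
by rewrite ler_wpM2l // mulr_ge0 // invr_ge0 mulr_ge0 // ltW.
Qed.
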